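(* (Optimality of the power inequality.) For $\alpha>0$ and $K>0$, let $P(\alpha,K)$ denote the statement: for every metric space $(\mathcal Q,d)$ and all $q,p,y,z\in\mathcal Q$ with $$d(y,q)^2-d(y,p)^2-d(z,q)^2+d(z,p)^2\le2\,d(y,z)\,d(q,p)$$ one has $$d(y,q)^{2\alpha}-d(y,p)^{2\alpha}-d(z,q)^{2\alpha}+d(z,p)^{2\alpha}\le K\,d(y,z)^{2\alpha-1}\,d(q,p).$$ Then: (a) if $\alpha\in[\frac12,1]$ and $K<8\alpha2^{-2\alpha}$, then $P(\alpha,K)$ is false; (b) if $\alpha>1$, then $P(\alpha,K)$ is false for every $K>0$; (c) if $\alpha\in(0,\frac12)$, then $P(\alpha,K)$ is false for every $K>0$.
   Context: For $\alpha<\frac12$ the power $d(y,z)^{2\alpha-1}$ has a negative exponent; the failure of the inequality is already witnessed by points with $d(y,z)>0$, so conventions for $d(y,z)=0$ are immaterial. *)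

(* Defs.v *)
From mathcomp Require Import all_boot all_order all_algebra.
From mathcomp Require Import all_classical all_reals all_analysis.

Set Implicit Arguments.
Unset Strict Implicit.
Unset Printing Implicit Defensive.

Import Order.TTheory GRing.Theory Num.Theory.

Local Open Scope ring_scope.

(* [powR] sends base 0 to 0 for every nonzero exponent,
   so for [alpha < 1/2] and [y = z] the right-hand side below is 0; the left-hand
   side is then 0 too, and the inequality can only fail at points with
   [0 < mdist y z]. *)
Definition power_inequality (R : realType) (alpha K : R) : Prop :=
  forall (Q : metricType R) (q p y z : Q),
    mdist y q ^+ 2 - mdist y p ^+ 2 - mdist z q ^+ 2 + mdist z p ^+ 2
      <= 2 * mdist y z * mdist q p ->
    mdist y q `^ (2 * alpha) - mdist y p `^ (2 * alpha)
      - mdist z q `^ (2 * alpha) + mdist z p `^ (2 * alpha)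
      <= K * mdist y z `^ (2 * alpha - 1) * mdist q p.

(* Main.v *)
Require Import Defs.
From HB Require Import structures.
From mathcomp Require Import all_boot all_order all_algebra.
From mathcomp Require Import all_classical all_reals all_analysis.
From mathcomp Require Import ring lra.

Import Order.TTheory GRing.Theory Num.Theory.

Local Open Scope ring_scope.

(** All counterexamples live on the real line.  There the hypothesis on the
    squared distances always holds, since its left-hand side equals
    [- 2 (y - z) (q - p)]; so the power inequality would have to hold for every
    four real numbers ([power_inequality_line]).  With [f t = |t|^a] and
    [a = 2 alpha], its left-hand side is a mixed second difference of [f].

    - For [a >= 1], put [y = 1], [z = -1], [q = -h], [p = h].  As [h] tends to
      [0], the ratio of [2 ((1 + h)^a - (1 - h)^a)] to [2 h] tends to
      [2 a = f'(1) - f'(-1)], and [d(y,z)^(a - 1) = 2^(a - 1)], which forces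
      [K >= a 2^(2 - a) = 8 alpha 2^(- 2 alpha)].
    - For [a > 2], the second difference of [f] with unit steps at [M] is at
      least [2 M^(a - 2)], which is unbounded in [M], while the right-hand side
      stays equal to [K].
    - For [a < 1], put [y = p = 1], [q = 1 - h], [z = 0]: the left-hand
      side is at least [h^a], because of the cusp of [f] at [0], whereas the
      right-hand side is [K h]; small [h] violates this.

    The first two cases use the tangent line inequality for real powers,
    [powR_ge_tangent], and the last one only monotonicity.  In each case an
    explicit value of [h] or [M] is chosen, so no limit is taken. *)

(** A carrier of its own, so that the topology generated by the distance is kept
    apart from the structures carried by [R] itself. *)
Definition real_line (R : realType) : Type := R.

HB.instance Definition _ (R : realType) := Choice.on (real_line R).

HB.instance Definition _ (R : realType) :=
  @isMetric.Build R (real_line R) (fun x y : R => `|x - y|)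
    (fun x => etrans (congr1 Num.norm (subrr x)) (normr0 R))
    (fun x y xy => subr0_eq (normr0_eq0 xy))
    (fun x y => distrC x y)
    (fun y x z => ler_distD y x z).

(** The hypothesis of the power inequality costs nothing here: the combination of
    squares is bilinear in [y - z] and [q - p]. *)
Lemma power_inequality_line (R : realType) (alpha K : R) :
  power_inequality alpha K -> forall q p y z : R,
    `|y - q| `^ (2 * alpha) - `|y - p| `^ (2 * alpha)
      - `|z - q| `^ (2 * alpha) + `|z - p| `^ (2 * alpha)
      <= K * `|y - z| `^ (2 * alpha - 1) * `|q - p|.
Proof.
move=> PK q p y z; apply: (PK (real_line R) q p y z); rewrite /mdist/=.
rewrite !real_normK ?num_real// -mulrA -normrM.
apply: le_trans (_ : 2 * ((y - z) * - (q - p)) <= _); first by lra.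
by rewrite ler_pM2l// mulrN -normrN ler_norm.
Qed.

(** Convexity of the [r]-th power, read off Young's inequality for the product
    [x * c^(r - 1)] with exponents [r] and [r / (r - 1)], whose second term is
    then a multiple of [c^r]. *)
Lemma powR_ge_tangent (R : realType) (r x c : R) :
  1 <= r -> 0 <= x -> 0 < c ->
  c `^ r + r * c `^ (r - 1) * (x - c) <= x `^ r.
Proof.
rewrite le_eqVlt => /predU1P[<-|r1] x0 c0.
  by rewrite subrr powRr0 !powRr1 ?(ltW c0)//; lra.
have r0 : 0 < r by lra.
have q0 : 0 < r / (r - 1) by rewrite divr_gt0// subr_gt0.
have rq : r^-1 + (r / (r - 1))^-1 = 1 by field; lra.
have := conjugate_powR x0 (powR_ge0 c (r - 1)) r0 q0 rq.
rewrite -powRrM (_ : (r - 1) * (r / (r - 1)) = r); last by field; lra.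
rewrite -(mulr_powRB1 (ltW c0) r0) -(ler_pM2r r0).
set C := c `^ (r - 1); set X := x `^ r.
rewrite (_ : (X / r + _) * r = X + (r - 1) * (c * C)); first by lra.
by field; lra.
Qed.

(** In terms of squares the exponent is [alpha], and the mean of [(M + 1)^2] and
    [(M - 1)^2] is [M^2 + 1], which exceeds [M^2] by [1].  Adding the tangent
    inequalities at [M^2 + 1] cancels the first-order terms and leaves
    [2 (M^2 + 1)^alpha], which exceeds [2 (M^2)^alpha] by at least
    [2 (M^2)^(alpha - 1)]. *)
Lemma second_difference_powR_ge (R : realType) (alpha M : R) :
  1 < alpha -> 1 <= M ->
  2 * M `^ (2 * (alpha - 1)) <=
  (M + 1) `^ (2 * alpha) - M `^ (2 * alpha)
    - M `^ (2 * alpha) + (M - 1) `^ (2 * alpha).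
Proof.
move=> a1 M1.
have sqE (t b : R) : 0 <= t -> t `^ (2 * b) = (t ^+ 2) `^ b.
  by move=> t0; rewrite powRrM powR_mulrn.
rewrite !sqE; try lra.
have c0 : 0 < M ^+ 2 + 1 by rewrite ltr_wpDl ?sqr_ge0.
have Tp := powR_ge_tangent _ _ _ _ (ltW a1) (sqr_ge0 (M + 1)) c0.
have Tm := powR_ge_tangent _ _ _ _ (ltW a1) (sqr_ge0 (M - 1)) c0.
have a0 : 0 < alpha by lra.
rewrite -(mulr_powRB1 (sqr_ge0 M) a0).
rewrite -(mulr_powRB1 (ltW c0) a0) in Tp Tm.
have : (M ^+ 2) `^ (alpha - 1) <= (M ^+ 2 + 1) `^ (alpha - 1).
  by rewrite ge0_ler_powR ?nnegrE ?sqr_ge0 ?(ltW c0)//; lra.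
move: Tp Tm; set C := (M ^+ 2 + 1) `^ _; set D := (M ^+ 2) `^ _.
move=> Tp Tm DC.
have : 0 <= (M ^+ 2 + 1) * (C - D) by rewrite mulr_ge0 ?subr_ge0 ?(ltW c0).
by lra.
Qed.

(** With [c = K 2^(a - 1)], the points [1, -1, -h, h] give
    [(1 + h)^a - (1 - h)^a <= c h], where [c < 2 a].  The first power is at least
    [1 + a h] by the tangent at [1], the second at most [1 / (1 + a h)] because
    the product of the two is [(1 - h^2)^a <= 1].  For [e = a h] this reads
    [e (2 + e) <= c h (1 + e)], which fails for small [e]. *)
Lemma power_inequality_constant_ge (R : realType) (alpha K : R) :
  2^-1 <= alpha -> 0 < K -> K < 8 * alpha * 2 `^ (- (2 * alpha)) ->
  ~ power_inequality alpha K.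
Proof.
move=> ha K0 hK /power_inequality_line PK.
set a := 2 * alpha in hK PK.
have a1 : 1 <= a by rewrite /a; lra.
have a0 : 0 < a by lra.
pose c := K * 2 `^ (a - 1).
have c0 : 0 < c by rewrite mulr_gt0// powR_gt0.
have c2a : c < 2 * a.
  move: hK; rewrite powRN ltr_pdivlMr ?powR_gt0// -(mulr_powRB1 _ a0)//.
  by rewrite /c /a; lra.
(* With this [e] one has [c = 2 a (1 - e)], and for [a h = e] the inequality
   [e (2 + e) <= c h (1 + e)] becomes [2 + e <= 2 (1 - e) (1 + e)], which is
   absurd. *)
pose e := 1 - c / (2 * a).
have ca : 0 < c / (2 * a) < 1.
  have a20 : 0 < 2 * a by lra.
  by rewrite divr_gt0//= ltr_pdivrMr// mul1r.
have e0 : 0 < e by rewrite /e; lra.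
have e1 : e < 1 by rewrite /e; lra.
have cE : c = 2 * a * (1 - e) by rewrite /e; field; lra.
pose h := e / a.
have h0 : 0 < h by rewrite divr_gt0.
have h1 : h < 1 by rewrite ltr_pdivrMr// mul1r; lra.
have hE : a * h = e by rewrite /h; field; lra.
have := PK (- h) h 1 (- 1).
rewrite (_ : 1 - - h = 1 + h); last by lra.
rewrite (_ : -1 - - h = - (1 - h)); last by lra.
rewrite (_ : -1 - h = - (1 + h)); last by lra.
rewrite (_ : - h - h = - (2 * h)); last by lra.
rewrite (_ : 1 - -1 = 2 :> R); last by lra.
rewrite !normrN !ger0_norm; try lra.
rewrite -/c.
have A1 : 1 + e <= (1 + h) `^ a.
  have h10 : 0 <= 1 + h by lra.
  have := powR_ge_tangent _ _ _ _ a1 h10 ltr01.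
  by rewrite !powR1 mulr1 addrAC subrr add0r hE.
have AB : (1 + h) `^ a * (1 - h) `^ a <= 1.
  rewrite -powRM; [|lra|lra].
  have hh : 0 <= (1 + h) * (1 - h) by rewrite mulr_ge0; lra.
  rewrite -[leRHS](congr1 (@^~ a) (powR1 R)) ge0_ler_powR ?nnegrE ?(ltW a0)//.
  by have := sqr_ge0 h; lra.
move: A1 AB (powR_ge0 (1 - h) a).
set A := (1 + h) `^ a; set B := (1 - h) `^ a => A1 AB B0.
have eB : (1 + e) * B <= 1 by apply: le_trans AB; rewrite ler_wpM2r.
have ch : c * h = 2 * e * (1 - e) by rewrite cE -hE; ring.
move=> H.
have H' : A - B <= 2 * e * (1 - e) by rewrite -ch; lra.
have eA : (1 + e) * (1 + e) <= (1 + e) * A by rewrite ler_pM2l//; lra.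
have : (1 + e) * (A - B) <= (1 + e) * (2 * e * (1 - e)).
  by rewrite ler_pM2l//; lra.
have e3 : 0 < e ^+ 2 * e by rewrite mulr_gt0// exprn_gt0.
have e2 : 0 < e ^+ 2 by rewrite exprn_gt0.
by lra.
Qed.

(** The points [q = 0], [p = 1], [y = M + 1], [z = M] turn the left-hand side into
    a second difference at [M] and the right-hand side into [K].  The number [M]
    solves [M^(2 (alpha - 1)) = K + 1], so the former is at least [2 (K + 1)]. *)
Lemma power_inequality_false_gt1 (R : realType) (alpha K : R) :
  1 < alpha -> 0 < K -> ~ power_inequality alpha K.
Proof.
move=> a1 K0 /power_inequality_line PK.
have b0 : 0 < 2 * (alpha - 1) by lra.
pose M := (K + 1) `^ (2 * (alpha - 1))^-1.
have M1 : 1 <= M.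
  by rewrite -(powRr0 (K + 1)) ler_powR ?invr_ge0 ?(ltW b0)//; lra.
have ME : M `^ (2 * (alpha - 1)) = K + 1.
  rewrite -powRrM mulVf ?gt_eqF// powRr1//; lra.
have := PK 0 1 (M + 1) M.
rewrite (_ : M + 1 - 1 = M) ?addrK// (_ : M + 1 - M = 1); last by lra.
rewrite !subr0 sub0r normrN normr1 powR1 !mulr1 !ger0_norm; try lra.
by have := second_difference_powR_ge _ _ _ a1 M1; rewrite ME; lra.
Qed.

(** At [y = p = 1], [q = 1 - h], [z = 0] the inequality reads
    [h^a - (1 - h)^a + 1 <= K h], hence [h^a <= K h].  The number [h] is chosen
    as the solution of [h^a = (K + 1) h]. *)
Lemma power_inequality_false_lt_half (R : realType) (alpha K : R) :
  0 < alpha -> alpha < 2^-1 -> 0 < K -> ~ power_inequality alpha K.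
Proof.
move=> a0 ha K0 /power_inequality_line PK.
set a := 2 * alpha in PK.
have a1 : a < 1 by rewrite /a; lra.
have a_gt0 : 0 < a by rewrite /a; lra.
pose h := (K + 1) `^ (- (1 - a)^-1).
have h0 : 0 < h by rewrite powR_gt0; lra.
have h1 : h <= 1.
  rewrite -(powRr0 (K + 1)) ler_powR ?oppr_le0 ?invr_ge0; lra.
have hE : h `^ a = (K + 1) * h.
  have aE : a = 1 + - (1 - a) by lra.
  rewrite aE powRD; last by rewrite (gt_eqF h0) implybT.
  rewrite powRr1 ?(ltW h0)// mulrC; congr (_ * _).
  rewrite -powRrM mulrNN mulVf ?powRr1//; lra.
have := PK (1 - h) 1 1 0.
rewrite !sub0r !subr0 subrr normr0 powR0 ?gt_eqF// subr0.
rewrite (_ : 1 - (1 - h) = h); last by lra.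
rewrite (_ : 1 - h - 1 = - h); last by lra.
rewrite !normrN normr1 !powR1 mulr1 !ger0_norm; try lra.
have : (1 - h) `^ a <= 1.
  rewrite -[leRHS](congr1 (@^~ a) (powR1 R)).
  by rewrite ge0_ler_powR ?nnegrE ?(ltW a_gt0)//; lra.
by rewrite hE; lra.
Qed.

Theorem mainTheorem4 (R : realType) :
  [/\ forall alpha K : R, 2^-1 <= alpha -> alpha <= 1 -> 0 < K ->
        K < 8 * alpha * 2 `^ (- (2 * alpha)) -> ~ power_inequality alpha K,
      forall alpha K : R, 1 < alpha -> 0 < K -> ~ power_inequality alpha K &
      forall alpha K : R, 0 < alpha -> alpha < 2^-1 -> 0 < K ->
        ~ power_inequality alpha K].
Proof.
split.
- by move=> alpha K ha _; exact: power_inequality_constant_ge.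
- exact: power_inequality_false_gt1.
- exact: power_inequality_false_lt_half.
Qed.
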